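(* Let $\mathbb{P}$ be the set of $m\times m$ positive definite Hermitian matrices. For $(A_1,\ldots,A_n)\in\mathbb{P}^n$ and a weight $\mathbf{w}=(w_1,\ldots,w_n)$, we have $$\left(\sum_{i=1}^n w_iA_i^{-1}\right)^{-1}\leq \mathfrak{G}_n(\mathbf{w};A_1,\ldots,A_n)\leq \sum_{i=1}^n w_iA_i.$$
   Context: The order is the Loewner order: $A\leq B$ iff $B-A$ is positive semidefinite. The trace metric on $\mathbb{P}$ is $\delta(A,B)=\left(\sum_{i=1}^{m}\log^2\lambda_i(A^{-1}B)\right)^{1/2}$, where $\lambda_1(X),\ldots,\lambda_m(X)$ are the eigenvalues of $X$ counted with multiplicity. A weight is a tuple $\mathbf{w}=(w_1,\ldots,w_n)$ of positive real numbers with $\sum_{i=1}^n w_i=1$. The weighted least squares mean of $(A_1,\ldots,A_n)\in\mathbb{P}^n$ is $\mathfrak{G}_n(\mathbf{w};A_1,\ldots,A_n)=\arg\min_{X\in\mathbb{P}}\sum_{i=1}^n w_i\delta^2(X,A_i)$; the minimizer exists and is unique (known fact). *)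

(* Defs.v *)
From HB Require Import structures.
From mathcomp Require Import all_boot all_order all_algebra.
From mathcomp Require Export complex.
From mathcomp Require Import all_classical all_reals all_analysis.

Set Implicit Arguments.
Unset Strict Implicit.
Unset Printing Implicit Defensive.

Import Order.TTheory GRing.Theory Num.Theory.

Local Open Scope ring_scope.
Local Open Scope sesquilinear_scope.
Local Open Scope complex_scope.

(* The order on a numClosedFieldType is partial: [0 <= z] and [0 < z] include
   the assertion that [z] is real. *)
Definition psdmx (C : numClosedFieldType) (m : nat) (M : 'M[C]_m) : Prop :=
  M \is hermsymmx /\
  forall v : 'cV[C]_m, 0 <= (v ^t* *m M *m v) ord0 ord0.

Definition pdmx (C : numClosedFieldType) (m : nat) (M : 'M[C]_m) : Prop :=
  M \is hermsymmx /\
  forall v : 'cV[C]_m, v != 0 -> 0 < (v ^t* *m M *m v) ord0 ord0.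

Definition loewner_le (C : numClosedFieldType) (m : nat) (A B : 'M[C]_m) : Prop :=
  psdmx (B - A).

(* Roots of the characteristic polynomial, repeated according to their
   algebraic multiplicity. *)
Definition eigenvalues (C : numClosedFieldType) (m : nat) (A : 'M[C]_m) : seq C :=
  sval (closed_field_poly_normal (char_poly A)).

Lemma char_poly_eigenvalues (C : numClosedFieldType) (m : nat) (A : 'M[C]_m) :
  char_poly A = \prod_(z <- eigenvalues A) ('X - z%:P).
Proof.
rewrite /eigenvalues; case: closed_field_poly_normal => r /= {1}->.
by rewrite (monicP (char_poly_monic A)) scale1r.
Qed.

(* For positive definite [A] and [B], the matrix [A^-1 B] is similar to the
   positive definite [A^(-1/2) B A^(-1/2)], so its eigenvalues are positive
   reals and taking their real part loses nothing. *)
Definition trace_dist (R : realType) (m : nat) (A B : 'M[R[i]]_m) : R :=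
  Num.sqrt (\sum_(l <- eigenvalues (invmx A *m B)) ln (complex.Re l) ^+ 2).

Definition is_weight (R : realType) (n : nat) (w : 'I_n -> R) : Prop :=
  (forall i, 0 < w i) /\ \sum_(i < n) w i = 1.

Definition is_least_squares_mean (R : realType) (m n : nat) (w : 'I_n -> R)
    (A : 'I_n -> 'M[R[i]]_m) (G : 'M[R[i]]_m) : Prop :=
  pdmx G /\
  forall X : 'M[R[i]]_m, pdmx X ->
    \sum_(i < n) w i * trace_dist G (A i) ^+ 2
      <= \sum_(i < n) w i * trace_dist X (A i) ^+ 2.

(* Main.v *)
Require Import Defs.
From HB Require Import structures.
From mathcomp Require Import all_boot all_order all_algebra.
From mathcomp Require Import all_classical all_reals all_analysis.
From mathcomp Require Import ring lra.

(** The least squares mean [G] is a critical point of the sum of squared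
    distances, and this gives the Karcher equation
      [\sum_i w_i log (G^(-1/2) A_i G^(-1/2)) = 0].
    Together with [1 - x^-1 <= ln x <= x - 1] it yields
      [\sum_i w_i B_i >= 1] and [\sum_i w_i B_i^-1 >= 1]
    for the whitened matrices [B_i = G^(-1/2) A_i G^(-1/2)].  Undoing the
    congruence, these say [\sum_i w_i A_i >= G] and
    [\sum_i w_i A_i^-1 >= G^-1]; inversion reverses the Loewner order, so the
    second one is the lower bound on [G].

    The Karcher equation needs no differentiation of eigenvalues.  Write
    [G^-1 = T T^*], so that [B_i = T^* A_i T], take an orthogonal projection
    [P], and compare [G] with the matrix [X] such that
    [X^-1 = T (1 + s P)^2 T^*], for a real [s] of either sign.  The
    eigenvalues of [X^-1 A_i] are those of [M = (1 + s P) B_i (1 + s P)].  On a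
    half-line [a <= x] with [0 < a], the function [ln ^ 2] lies below a parabola
    that touches it at a given point [b], and the curvature depends on [a] and
    [b] only ([ln_sqr_tangent]).  Such a scalar bound between the spectra of two
    Hermitian matrices passes to the traces (Klein's inequality,
    [klein_upper]), whence
      [tr (log M)^2 <= tr (log B_i)^2 + 4 s tr (log B_i P) + O(s^2)]
    ([sum_ln_sqr_stretch]).  Minimality of [G] makes the weighted sum of the
    linear terms vanish ([karcher_equation]).  Finally a Hermitian matrix is
    positive semidefinite as soon as its product with every orthogonal
    projection has nonnegative trace ([psdmx_proj]), so testing against
    projections is enough ([weighted_spectral_ge1]). *)

Set Implicit Arguments.
Unset Strict Implicit.
Unset Printing Implicit Defensive.

Import Order.TTheory GRing.Theory Num.Theory.

Local Open Scope ring_scope.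
Local Open Scope sesquilinear_scope.
Local Open Scope complex_scope.

(** * Adjoints and the Loewner order *)

Section Adjoint.
Variable C : numClosedFieldType.

Lemma adjmxM m n p (A : 'M[C]_(m, n)) (B : 'M[C]_(n, p)) :
  (A *m B)^t* = B^t* *m A^t*.
Proof. by rewrite trmx_mul map_mxM. Qed.

Lemma adjmxD m n (A B : 'M[C]_(m, n)) : (A + B)^t* = A^t* + B^t*.
Proof. by rewrite linearD /= map_mxD. Qed.

Lemma adjmxB m n (A B : 'M[C]_(m, n)) : (A - B)^t* = A^t* - B^t*.
Proof. by rewrite linearB /= map_mxB. Qed.

Lemma adjmx_sum m n I (r : seq I) (F : I -> 'M[C]_(m, n)) :
  (\sum_(i <- r) F i)^t* = \sum_(i <- r) (F i)^t*.
Proof.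
by apply: (big_morph (fun X : 'M[C]_(m, n) => X^t*)) => [X Y|];
  rewrite ?adjmxD// trmx0 map_mx0.
Qed.

Lemma adjmxZ m n (c : C) (A : 'M[C]_(m, n)) : (c *: A)^t* = c^* *: A^t*.
Proof. by rewrite linearZ /= map_mxZ. Qed.

Lemma adjmx1 n : (1%:M : 'M[C]_n)^t* = 1%:M.
Proof. by rewrite trmx1 map_mx1. Qed.

Lemma hermsymmxP n (A : 'M[C]_n) : A \is hermsymmx <-> A^t* = A.
Proof.
split=> [/is_hermitianmxP|h]; first by rewrite expr0 scale1r => <-.
by apply/is_hermitianmxP; rewrite expr0 scale1r h.
Qed.

Lemma unitarymxPV n (U : 'M[C]_n) : U \is unitarymx -> U^t* *m U = 1%:M.
Proof. by move=> /unitarymxP/mulmx1C. Qed.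

Lemma adjmx_unit n (Z : 'M[C]_n) : Z \in unitmx -> Z^t* \in unitmx.
Proof. by rewrite map_unitmx unitmx_tr. Qed.

Lemma adjmx_inv n (Z : 'M[C]_n) : (invmx Z)^t* = invmx (Z^t*).
Proof. by rewrite trmx_inv map_invmx. Qed.

Lemma psdmx_congr m n (A : 'M[C]_m) (Z : 'M[C]_(m, n)) :
  psdmx A -> psdmx (Z^t* *m A *m Z).
Proof.
move=> [/hermsymmxP hA pA]; split.
  by apply/hermsymmxP; rewrite !adjmxM trmxCK hA mulmxA.
by move=> v; have := pA (Z *m v); rewrite adjmxM !mulmxA.
Qed.

(** Lets an inequality be checked after whitening, on [Z^* A Z]. *)
Lemma psdmx_congr_unit n (A Z : 'M[C]_n) :
  Z \in unitmx -> psdmx (Z^t* *m A *m Z) -> psdmx A.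
Proof.
move=> uZ /(@psdmx_congr _ _ _ (invmx Z)); rewrite adjmx_inv !mulmxA.
by rewrite mulVmx ?adjmx_unit// mul1mx mulmxK.
Qed.

Lemma psdmxD n (A B : 'M[C]_n) : psdmx A -> psdmx B -> psdmx (A + B).
Proof.
move=> [/hermsymmxP hA pA] [/hermsymmxP hB pB]; split.
  by apply/hermsymmxP; rewrite adjmxD hA hB.
by move=> v; rewrite mulmxDr mulmxDl mxE addr_ge0.
Qed.

Lemma pdmxW n (A : 'M[C]_n) : pdmx A -> psdmx A.
Proof.
move=> [hA pA]; split=> // v; have [->|/pA/ltW//] := eqVneq v 0.
by rewrite mulmx0 mxE.
Qed.

Lemma pdmx_unit n (A : 'M[C]_n) : pdmx A -> A \in unitmx.
Proof.
move=> [hA pA]; rewrite -unitmx_tr -row_free_unit -kermx_eq0.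
apply/eqP/row_matrixP => i; rewrite row0; apply/eqP; apply: contraT => nz.
have := pA (row i (kermx A^T))^T; rewrite trmx_eq0 => /(_ nz).
rewrite -mulmxA; have -> : A *m (row i (kermx A^T))^T = 0.
  by apply: trmx_inj; rewrite trmx_mul trmxK -row_mul mulmx_ker row0 trmx0.
by rewrite mulmx0 mxE ltxx.
Qed.

Lemma pdmx_congr n (A Z : 'M[C]_n) :
  Z \in unitmx -> pdmx A -> pdmx (Z^t* *m A *m Z).
Proof.
move=> uZ [/hermsymmxP hA pA]; split.
  by apply/hermsymmxP; rewrite !adjmxM trmxCK hA mulmxA.
move=> v nz; have := pA (Z *m v); rewrite adjmxM !mulmxA; apply.
by apply: contra nz => /eqP e; rewrite -(mulKmx uZ v) e mulmx0.
Qed.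

Lemma adj_col_self n (v : 'cV[C]_n) :
  (v^t* *m v) 0 0 = \sum_i `|v i 0| ^+ 2.
Proof. by rewrite mxE; apply: eq_bigr => i _; rewrite !mxE normCKC. Qed.

Lemma pdmx1 n : pdmx (1%:M : 'M[C]_n).
Proof.
split=> [|v nz]; first by apply/hermsymmxP; rewrite adjmx1.
rewrite mulmx1 adj_col_self lt_def sumr_ge0 ?andbT; last first.
  by move=> i _; rewrite exprn_ge0.
apply: contra nz; rewrite psumr_eq0 => [/allP h|i _]; last by rewrite exprn_ge0.
apply/eqP/matrixP => i j; rewrite ord1 mxE; apply/eqP.
by have := h i (mem_index_enum _); rewrite expf_eq0 normr_eq0.
Qed.

Lemma pdmx_inv n (A : 'M[C]_n) : pdmx A -> pdmx (invmx A).
Proof.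
move=> pA; have uA := pdmx_unit pA; have [/hermsymmxP hA _] := pA.
have := @pdmx_congr _ A (invmx A) _ pA; rewrite unitmx_inv => /(_ uA).
by rewrite adjmx_inv hA mulVmx// mul1mx.
Qed.

(** Inversion is antitone because the gap between the inverses is a sum of two
    congruences,
      [K^-1 - H^-1 = (H^-1 - K^-1) K (H^-1 - K^-1) + H^-1 (H - K) H^-1]. *)
Lemma loewner_le_inv n (H K : 'M[C]_n) :
  pdmx H -> pdmx K -> loewner_le K H -> loewner_le (invmx H) (invmx K).
Proof.
move=> pH pK KH; rewrite /loewner_le.
have uH := pdmx_unit pH; have uK := pdmx_unit pK.
have [/hermsymmxP hH _] := pH; have [/hermsymmxP hK _] := pK.
have -> : invmx K - invmx H =
    (invmx H - invmx K)^t* *m K *m (invmx H - invmx K)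
    + (invmx H)^t* *m (H - K) *m invmx H.
  rewrite adjmxB !adjmx_inv hH hK !(mulmxBl, mulmxBr) mulVmx// (mulVmx uH).
  rewrite mulmxK// !mul1mx; move: (invmx H *m K *m invmx H) (invmx H) (invmx K) => X Y Z.
  by apply/matrixP => i j; rewrite !mxE; ring.
apply: psdmxD; last exact: psdmx_congr.
exact/psdmx_congr/pdmxW.
Qed.

Lemma psdmx_pdmxD n (A B : 'M[C]_n) : psdmx A -> pdmx B -> pdmx (A + B).
Proof.
move=> [/hermsymmxP hA pA] [/hermsymmxP hB pB]; split.
  by apply/hermsymmxP; rewrite adjmxD hA hB.
by move=> v nz; rewrite mulmxDr mulmxDl mxE ltr_wpDl// pB.
Qed.

Lemma psdmx_trace_ge0 n (A : 'M[C]_n) : psdmx A -> 0 <= \tr A.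
Proof.
move=> [_ pA]; apply: sumr_ge0 => i _; have := pA (delta_mx i 0).
by rewrite trmx_delta map_delta_mx -rowE -colE !mxE.
Qed.

Lemma gram_pdmx n (Z : 'M[C]_n) : Z \in unitmx -> pdmx (invmx (Z *m Z^t*)).
Proof.
move=> uZ; apply: pdmx_inv.
have := pdmx_congr (adjmx_unit uZ) (pdmx1 n).
by rewrite trmxCK mulmx1.
Qed.

Lemma invmx_congr n (A T : 'M[C]_n) : T \in unitmx -> A \in unitmx ->
  invmx (T^t* *m A *m T) = invmx T *m invmx A *m (invmx T)^t*.
Proof.
move=> uT uA; have uT' := adjmx_unit uT.
have uTAT : T^t* *m A *m T \in unitmx by rewrite !unitmx_mul uT' uA.
apply: (can_inj (mulKmx uTAT)); rewrite mulmxV// adjmx_inv !mulmxA.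
by rewrite mulmxK// mulmxK// mulmxV.
Qed.

Lemma invmx_congr_eq1 n (A T : 'M[C]_n) : T \in unitmx -> T^t* *m A *m T = 1%:M ->
  invmx A = T *m T^t*.
Proof.
move=> uT e; have uT' := adjmx_unit uT.
have eA : A *m (T *m T^t*) = 1%:M.
  by apply: (can_inj (mulKmx uT')); rewrite !mulmxA e mul1mx mulmx1.
have [uA _] := mulmx1_unit eA.
by apply: (can_inj (mulKmx uA)); rewrite eA mulmxV.
Qed.

Lemma proj_psd n (P : 'M[C]_n) : P^t* = P -> P *m P = P -> psdmx P.
Proof.
move=> hP PP; have := psdmx_congr P (pdmxW (pdmx1 n)).
by rewrite hP mulmx1 PP.
Qed.

Lemma proj_compl_psd n (P : 'M[C]_n) : P^t* = P -> P *m P = P -> psdmx (1%:M - P).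
Proof.
move=> hP PP; apply: proj_psd; first by rewrite adjmxB adjmx1 hP.
by rewrite mulmxBl !mulmxBr !mulmx1 mul1mx PP subrr subr0.
Qed.
End Adjoint.

(** * Unitary diagonalization *)

Section UnitaryDiag.
Variables (C : numClosedFieldType) (n : nat).
Implicit Types (U : 'M[C]_n) (d e : 'rV[C]_n).

Definition udiag U d : 'M[C]_n := U^t* *m diag_mx d *m U.

Lemma udiagD U d e : udiag U d + udiag U e = udiag U (d + e).
Proof. by rewrite /udiag linearD /= mulmxDr mulmxDl. Qed.

Lemma udiag_adj U d : (udiag U d)^t* = udiag U (map_mx Num.conj d).
Proof. by rewrite /udiag !adjmxM trmxCK mulmxA tr_diag_mx map_diag_mx. Qed.

Lemma udiagZ U c d : c *: udiag U d = udiag U (c *: d).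
Proof. by rewrite /udiag linearZ /= -scalemxAr -scalemxAl. Qed.

Lemma udiagM U d e : U \is unitarymx ->
  udiag U d *m udiag U e = udiag U (\row_j (d 0 j * e 0 j)).
Proof.
move=> /unitarymxP uU; rewrite /udiag -mulmx_diag !mulmxA.
by rewrite -(mulmxA _ U) uU mulmx1.
Qed.

Lemma udiag1 U : U \is unitarymx -> udiag U (const_mx 1) = 1%:M.
Proof. by move=> uU; rewrite /udiag diag_const_mx mulmx1 unitarymxPV. Qed.

Lemma udiag_psd U d : (forall j, 0 <= d 0 j) -> psdmx (udiag U d).
Proof.
move=> d0; apply: psdmx_congr; split.
  apply/hermsymmxP; rewrite tr_diag_mx map_diag_mx; congr diag_mx.
  by apply/rowP => j; rewrite mxE; apply/conj_Creal/ger0_real.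
move=> v; rewrite -mulmxA mxE sumr_ge0// => i _.
by rewrite mul_diag_mx !mxE mulrCA mulr_ge0// mulrC mul_conjC_ge0.
Qed.

(** The [k]-th column of [U^*] is a unit eigenvector for [d 0 k], so bounds on
    the quadratic form become bounds on the eigenvalues. *)
Lemma udiag_entry U d k : U \is unitarymx ->
  ((U^t* *m delta_mx k (0 : 'I_1))^t* *m udiag U d
    *m (U^t* *m delta_mx k (0 : 'I_1))) 0 0 = d 0 k.
Proof.
move=> uU; rewrite adjmxM trmxCK /udiag !mulmxA.
rewrite -(mulmxA _ U) (unitarymxP uU) mulmx1 -(mulmxA _ U) (unitarymxP uU) mulmx1.
by rewrite trmx_delta map_delta_mx -rowE -colE !mxE eqxx mulr1n.
Qed.

Lemma udiag_entry_neq0 U k : U \is unitarymx ->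
  U^t* *m delta_mx k (0 : 'I_1) != 0.
Proof.
move=> uU; apply: contraT => /negPn/eqP /(congr1 (mulmx U)).
rewrite mulmxA (unitarymxP uU) mul1mx mulmx0 => /matrixP/(_ k 0).
by rewrite !mxE !eqxx => /eqP; rewrite oner_eq0.
Qed.

(** With [V = W U^*], the weights [|V k j|^2] are nonnegative and the same for all
    pairs of spectra: this is what turns scalar inequalities between eigenvalues into
    trace inequalities. *)
Lemma udiag_tr W U d e :
  \tr (udiag W d *m udiag U e) =
  \sum_k \sum_j `|(W *m U^t*) k j| ^+ 2 * d 0 k * e 0 j.
Proof.
set V := W *m U^t*.
have -> : \tr (udiag W d *m udiag U e) = \tr (diag_mx d *m (V *m (diag_mx e *m V^t*))).
  rewrite /udiag /V adjmxM trmxCK -!mulmxA mxtrace_mulC.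
  by rewrite -!mulmxA.
apply: eq_bigr => k _; rewrite mul_diag_mx !mxE mulr_sumr; apply: eq_bigr => j _.
by rewrite mul_diag_mx !mxE normCK; ring.
Qed.

Lemma tr_udiag W d : W \is unitarymx -> \tr (udiag W d) = \sum_k d 0 k.
Proof.
move=> /unitarymxP uW; rewrite /udiag -mulmxA mxtrace_mulC -mulmxA uW mulmx1.
exact: mxtrace_diag.
Qed.

Lemma pdmx_udiag A : pdmx A ->
  exists U d, [/\ U \is unitarymx, forall j, 0 < d 0 j & A = udiag U d].
Proof.
move=> [hA pA]; have uU := spectral_unitarymx A.
have /orthomx_spectralP := hermitian_normalmx hA.
rewrite invmx_unitary// -/(udiag _ _) => eA.
exists (spectralmx A), (spectral_diag A); split=> // j.
by rewrite -(udiag_entry (spectral_diag A) j uU) -eA pA ?udiag_entry_neq0.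
Qed.

Lemma char_poly_conj (Z A : 'M[C]_n) : Z \in unitmx ->
  char_poly (invmx Z *m A *m Z) = char_poly A.
Proof.
move=> uZ; rewrite /char_poly.
have e : map_mx polyC (invmx Z) *m map_mx polyC Z = 1%:M.
  by rewrite -map_mxM mulVmx// map_mx1.
have -> : char_poly_mx (invmx Z *m A *m Z) =
    map_mx polyC (invmx Z) *m char_poly_mx A *m map_mx polyC Z.
  by rewrite /char_poly_mx mulmxBr mulmxBl scalar_mxC -(mulmxA 'X%:M) e mulmx1 !map_mxM.
by rewrite !det_mulmx mulrAC -det_mulmx e det1 mul1r.
Qed.

Lemma udiag_char_poly U d : U \is unitarymx ->
  char_poly (udiag U d) = \prod_j ('X - (d 0 j)%:P).
Proof.
move=> uU; rewrite /udiag -(invmx_unitary uU) char_poly_conj ?unitarymx_unit//.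
rewrite char_poly_trig ?diag_mx_is_trig//.
by apply: eq_bigr => j _; rewrite mxE eqxx mulr1n.
Qed.
End UnitaryDiag.

(** * Real trace and real spectrum *)

Section RealPart.
Variable R : realType.

Lemma ReD (x y : R[i]) : complex.Re (x + y) = complex.Re x + complex.Re y.
Proof. by case: x y => ? ? []. Qed.

Lemma ReN (x : R[i]) : complex.Re (- x) = - complex.Re x.
Proof. by case: x. Qed.

Lemma ReZ (r : R) (x : R[i]) : complex.Re (r%:C * x) = r * complex.Re x.
Proof. by case: x => a b /=; rewrite mul0r subr0. Qed.

Lemma Re_sum I (s : seq I) (P : pred I) (F : I -> R[i]) :
  complex.Re (\sum_(k <- s | P k) F k) = \sum_(k <- s | P k) complex.Re (F k).
Proof. by apply: (big_morph _ ReD). Qed.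

Lemma conj_realC (r : R) : Num.conj (r%:C) = r%:C.
Proof. by apply: conj_Creal; apply/complex_realP; exists r. Qed.

End RealPart.

(** Locked, like [specmx] below: over the concrete field [R[i]] a failed
    unification would otherwise unfold the complex arithmetic. *)
HB.lock Definition retr (R : realType) (n : nat) (M : 'M[R[i]]_n) : R :=
  complex.Re (\tr M).

Section ReTraceTheory.
Variables (R : realType) (n : nat).
Implicit Types (M N : 'M[R[i]]_n).

Lemma retrD M N : retr (M + N) = retr M + retr N.
Proof. by rewrite retr.unlock mxtraceD ReD. Qed.

Lemma retrN M : retr (- M) = - retr M.
Proof. by rewrite retr.unlock linearN /= ReN. Qed.

Lemma retrZ (r : R) M : retr (r%:C *: M) = r * retr M.
Proof. by rewrite retr.unlock mxtraceZ ReZ. Qed.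

Lemma retr_mulC M N : retr (M *m N) = retr (N *m M).
Proof. by rewrite retr.unlock mxtrace_mulC. Qed.

Lemma retr_sum I (s : seq I) (P : pred I) (F : I -> 'M[R[i]]_n) :
  retr (\sum_(k <- s | P k) F k) = \sum_(k <- s | P k) retr (F k).
Proof. by rewrite retr.unlock (linear_sum (@mxtrace _ n)) Re_sum. Qed.

End ReTraceTheory.

(** For a unitary [U], the Hermitian matrix with eigenvalues [g] whose
    eigenvectors are the columns of [U^*].  Functional calculus is built in:
    [specmx U (phi \o g)] is [phi] of the matrix [specmx U g]. *)
HB.lock Definition specmx (R : realType) (n : nat) (U : 'M[R[i]]_n)
  (g : 'I_n -> R) : 'M[R[i]]_n := udiag U (\row_j (g j)%:C).

Section RealSpectrum.
Variables (R : realType) (n : nat).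
Implicit Types (M N : 'M[R[i]]_n) (U W : 'M[R[i]]_n) (f g : 'I_n -> R).

Lemma eq_specmx U f g : f =1 g -> specmx U f = specmx U g.
Proof. by move=> /funext ->. Qed.

Lemma specmx_adj U g : (specmx U g)^t* = specmx U g.
Proof.
rewrite specmx.unlock [LHS]udiag_adj; congr udiag; apply/rowP => j; rewrite !mxE.
exact: conj_realC.
Qed.

Lemma specmx_psd U g : (forall j, 0 <= g j) -> psdmx (specmx U g).
Proof. by move=> g0; rewrite specmx.unlock; apply: udiag_psd => j; rewrite mxE ler0c. Qed.

Lemma specmxD U f g : specmx U f + specmx U g = specmx U (fun j => f j + g j).
Proof.
by rewrite specmx.unlock [LHS]udiagD; congr udiag; apply/rowP => j; rewrite !mxE rmorphD.
Qed.

Lemma specmxZ U (r : R) g : r%:C *: specmx U g = specmx U (fun j => r * g j).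
Proof.
by rewrite specmx.unlock [LHS]udiagZ; congr udiag; apply/rowP => j; rewrite !mxE rmorphM.
Qed.

Lemma specmxB U f g : specmx U f - specmx U g = specmx U (fun j => f j - g j).
Proof.
rewrite -scaleN1r -(rmorph1 (real_complex R)) -rmorphN specmxZ specmxD.
by apply: eq_specmx => j; rewrite mulN1r.
Qed.

Lemma specmxM U f g : U \is unitarymx ->
  specmx U f *m specmx U g = specmx U (fun j => f j * g j).
Proof.
move=> uU; rewrite specmx.unlock [LHS](udiagM _ _ uU); congr udiag.
by apply/rowP => j; rewrite !mxE rmorphM.
Qed.

Lemma specmx1 U : U \is unitarymx -> specmx U (fun=> 1) = 1%:M.
Proof.
move=> uU; rewrite specmx.unlock -[RHS](udiag1 uU); congr udiag.
by apply/rowP => j; rewrite !mxE.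
Qed.

Lemma specmxB_cst U g (c : R) : U \is unitarymx ->
  specmx U (fun j => g j - c) = specmx U g - c%:C *: 1%:M.
Proof.
move=> uU; rewrite -(specmx1 uU) -scaleNr -rmorphN specmxZ specmxD.
by apply: eq_specmx => j; rewrite mulr1.
Qed.

Lemma pdmx_specmx M : pdmx M ->
  exists U g, [/\ U \is unitarymx, forall j, 0 < g j & M = specmx U g].
Proof.
move=> /pdmx_udiag[U [d [uU d0 ->]]].
exists U, (fun j => complex.Re (d 0 j)); split=> [|j|]; first exact: uU.
  by have := d0 j; rewrite ltcE => /andP[].
rewrite specmx.unlock; congr udiag; apply/rowP => j; rewrite mxE RRe_real//.
exact/ger0_real/ltW.
Qed.

Lemma specmx_psd_ge0 W g :
  W \is unitarymx -> psdmx (specmx W g) -> forall k, 0 <= g k.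
Proof.
move=> uW; rewrite specmx.unlock => -[_ pM] k; have := pM (W^t* *m delta_mx k 0).
by rewrite udiag_entry// mxE ler0c.
Qed.

Lemma retr_specmx W f : W \is unitarymx -> retr (specmx W f) = \sum_k f k.
Proof.
move=> uW; rewrite specmx.unlock retr.unlock tr_udiag// Re_sum.
by apply: eq_bigr => k _; rewrite mxE.
Qed.

Lemma retr_specmx_mul W U f g :
  retr (specmx W f *m specmx U g) =
  \sum_k \sum_j complex.Re (`|(W *m U^t*) k j| ^+ 2) * f k * g j.
Proof.
rewrite specmx.unlock retr.unlock udiag_tr Re_sum; apply: eq_bigr => k _; rewrite Re_sum.
apply: eq_bigr => j _; rewrite !mxE mulrAC mulrC ReZ mulrC.
by rewrite (mulrC _ (g j)%:C) ReZ; ring.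
Qed.

End RealSpectrum.

Section RealPsd.
Variables (R : realType) (m : nat).
Implicit Types (M P G : 'M[R[i]]_m).

Lemma psdmxZ (r : R) M : 0 <= r -> psdmx M -> psdmx (r%:C *: M).
Proof.
move=> r0 [/hermsymmxP hM pM]; split.
  by apply/hermsymmxP; rewrite adjmxZ hM conj_realC.
by move=> v; rewrite -scalemxAr -scalemxAl mxE mulr_ge0// ler0c.
Qed.

(** The trace equals that of the congruent matrix [P M P]. *)
Lemma retr_mul_proj_ge0 M P :
  psdmx M -> P^t* = P -> P *m P = P -> 0 <= retr (M *m P).
Proof.
move=> pM hP PP; rewrite -PP mulmxA retr_mulC mulmxA -{1}hP retr.unlock.
have := psdmx_trace_ge0 (psdmx_congr P pM).
by rewrite lecE => /andP[].
Qed.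

(** Tested on the rank-one projection [P = c^-1 v v^*], [c = v^* v], the trace
    [tr (M P)] is [c^-1 (v^* M v)]. *)
Lemma psdmx_proj M : M^t* = M ->
  (forall P, P^t* = P -> P *m P = P -> 0 <= retr (M *m P)) -> psdmx M.
Proof.
move=> hM h; split=> [|v]; first exact/hermsymmxP.
have [->|nz] := eqVneq v 0; first by rewrite mulmx0 mxE.
have [_ /(_ v nz)] := pdmx1 R[i] m; rewrite mulmx1.
set c := (v^t* *m v) 0 0 => c0.
have vv : v^t* *m v = c%:M by rewrite [LHS]mx11_scalar.
have cr : Num.conj c^-1 = c^-1 by apply/conj_Creal/ger0_real; rewrite invr_ge0 ltW.
pose P := c^-1 *: (v *m v^t*).
have hP : P^t* = P by rewrite /P adjmxZ cr adjmxM trmxCK.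
have PP : P *m P = P.
  rewrite /P -scalemxAl -scalemxAr mulmxA -(mulmxA v) vv mul_mx_scalar.
  by rewrite -scalemxAl scalerA mulVf ?gt_eqF// scale1r.
have := h P hP PP.
set q := (v^t* *m M *m v) 0 0.
have -> : retr (M *m P) = complex.Re (c^-1 * q).
  rewrite retr.unlock /P -scalemxAr mxtraceZ mulmxA mxtrace_mulC mulmxA.
  by rewrite /q trace_mx11.
have qr : q \is Num.real.
  apply/CrealP; rewrite /q.
  have -> : Num.conj ((v^t* *m M *m v) 0 0) = ((v^t* *m M *m v)^t*) 0 0.
    by rewrite !mxE.
  by rewrite !adjmxM trmxCK hM mulmxA.
move=> Req; have : 0 <= c^-1 * q.
  rewrite -[c^-1 * q]RRe_real ?ler0c//; apply: rpredM => //.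
  by apply/ger0_real; rewrite invr_ge0 ltW.
by rewrite pmulr_rge0// invr_gt0.
Qed.

(** The witness is [G^(-1/2)], obtained from the spectral decomposition of [G]. *)
Lemma whitening G : pdmx G ->
  exists2 T : 'M[R[i]]_m, T \in unitmx & T^t* *m G *m T = 1%:M.
Proof.
move=> /pdmx_specmx[V [g [uV g0 ->]]].
pose T := specmx V (fun j => (Num.sqrt (g j))^-1); exists T; last first.
  rewrite specmx_adj !specmxM// -(specmx1 uV); apply: eq_specmx => j.
  rewrite -[X in _ * X * _](sqr_sqrtr (ltW (g0 j))); field.
  by rewrite gt_eqF// sqrtr_gt0.
have : T *m specmx V (fun j => Num.sqrt (g j)) = 1%:M.
  rewrite specmxM// -(specmx1 uV); apply: eq_specmx => j.
  by rewrite mulVf// gt_eqF// sqrtr_gt0.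
by case/mulmx1_unit.
Qed.

Lemma invmx_specmx U (b : 'I_m -> R) : U \is unitarymx -> (forall j, 0 < b j) ->
  invmx (specmx U b) = specmx U (fun j => (b j)^-1).
Proof.
move=> uU b0.
have e : specmx U b *m specmx U (fun j => (b j)^-1) = 1%:M.
  rewrite specmxM// -(specmx1 uU); apply: eq_specmx => j.
  by rewrite mulfV// gt_eqF.
have [uB _] := mulmx1_unit e.
by apply: (can_inj (mulKmx uB)); rewrite e mulmxV.
Qed.

End RealPsd.

(** * Scalar estimates for the logarithm *)

Section RealAnalysis.
Variable R : realType.

Lemma ln_le_subr1 (x : R) : 0 < x -> ln x <= x - 1.
Proof.
move=> x0; have := @le_ln1Dx R (x - 1); rewrite (addrC 1) subrK; apply.
by rewrite ltrBDl subrr.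
Qed.

Lemma ln_ge_1subV (x : R) : 0 < x -> 1 - x^-1 <= ln x.
Proof.
move=> x0; have := @ln_le_subr1 x^-1; rewrite invr_gt0 => /(_ x0).
by rewrite lnV ?posrE//; lra.
Qed.

(** With [x = ln (l / b)], the square is [(ln b + x)^2], and [x] lies between
    [(l - b) / l] and [(l - b) / b].  Replacing [x] by the upper end in the
    cross term and bounding [x^2] both cost a multiple of
    [((l - b) / a)^2]. *)
Lemma ln_sqr_tangent (a b l : R) : 0 < a -> a <= b -> a <= l ->
  ln l ^+ 2 <= ln b ^+ 2 + 2 * (ln b / b) * (l - b)
               + (2 + 2 * `|ln b|) / a ^+ 2 * (l - b) ^+ 2.
Proof.
move=> a0 ab al; have b0 := lt_le_trans a0 ab; have l0 := lt_le_trans a0 al.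
set c := ln b; set D := l - b.
have r0 : 0 < l / b by rewrite divr_gt0.
have -> : ln l = c + ln (l / b) by rewrite ln_div ?posrE// /c; lra.
have := ln_ge_1subV r0; have := ln_le_subr1 r0.
have -> : l / b - 1 = D / b by rewrite /D; field; rewrite gt_eqF.
have -> : 1 - (l / b)^-1 = D / l.
  by rewrite /D; field; rewrite !gt_eqF.
set x := ln _; set q := D / b; set p := D / l => xq px.
have aV : 0 < a^-1 by rewrite invr_gt0.
have bV : 0 < b^-1 <= a^-1 by rewrite invr_gt0 b0 lef_pV2.
have lV : 0 < l^-1 <= a^-1 by rewrite invr_gt0 l0 lef_pV2.
pose E := D ^+ 2 / a ^+ 2.
have sqE u : 0 < u <= a^-1 -> (D * u) ^+ 2 <= E.
  move=> /andP[u0 ua]; rewrite /E exprMn -exprVn ler_wpM2l ?sqr_ge0//.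
  by rewrite lerXn2r// nnegrE ltW.
have pE := sqE _ lV; have qE := sqE _ bV; rewrite -/p -/q in pE qE.
have gapE : q - x <= E.
  apply: le_trans (_ : q - p <= _); first lra.
  have -> : q - p = D ^+ 2 * (b^-1 * l^-1).
    by rewrite /q /p /D; field; rewrite !gt_eqF.
  rewrite /E -exprVn ler_wpM2l ?sqr_ge0// expr2.
  by case/andP: bV => ? ?; case/andP: lV => ? ?; rewrite ler_pM// ltW.
have xE : x ^+ 2 <= 2 * E.
  case: (leP 0 x) => x0; first by have : x ^+ 2 <= q ^+ 2; nra.
  by have : x ^+ 2 <= p ^+ 2; nra.
have cE : 2 * c * (x - q) <= 2 * `|c| * E.
  apply: le_trans (ler_norm _) _; rewrite !normrM [`|2|]ger0_norm//.
  rewrite ler_wpM2l ?mulr_ge0// ler0_norm; lra.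
have -> : (2 + 2 * `|c|) / a ^+ 2 * D ^+ 2 = (2 + 2 * `|c|) * E.
  by rewrite /E; field; rewrite gt_eqF.
have -> : 2 * (c / b) * D = 2 * c * q by rewrite /q; field; rewrite gt_eqF.
nra.
Qed.

(** Otherwise a small step [s] against the sign of [L] makes the linear term
    win. *)
Lemma first_order_zero (L K : R) :
  (forall s, `|s| <= 2^-1 -> 0 <= L * s + K * s ^+ 2) -> L = 0.
Proof.
move=> h; apply/eqP; apply: contraT => L0.
(* The step is [s = - L t]; [d] is large enough that [|s| <= 1/2] and [K t < 1]. *)
pose d := 2 * `|L| + `|K| + 1; pose t := d^-1.
have nL : 0 < `|L| by rewrite normr_gt0.
have nK : 0 <= `|K| by [].
have d0 : 0 < d by rewrite /d; lra.
have t0 : 0 < t by rewrite invr_gt0.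
have td : t * d = 1 by rewrite /t mulVf ?gt_eqF.
have tK : K * t < 1.
  apply: le_lt_trans (_ : `|K| * t < 1); first by rewrite ler_wpM2r ?ler_norm// ltW.
  by rewrite -td mulrC ltr_pM2l// /d; lra.
have := h (- L * t); rewrite normrM normrN (gtr0_norm t0).
have -> : `|L| * t <= 2^-1 = true by apply/idP; rewrite /d in td; nra.
move=> /(_ isT); have L2 : 0 < L ^+ 2 by rewrite exprn_even_gt0.
have -> : L * (- L * t) + K * (- L * t) ^+ 2 = L ^+ 2 * (t * (K * t - 1)) by ring.
by rewrite pmulr_rge0// pmulr_rge0// ; lra.
Qed.

Lemma posfun_lbound n (b : 'I_n -> R) :
  (forall j, 0 < b j) -> exists2 a : R, 0 < a & forall j, a <= b j.
Proof.
move=> b0.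
(* [S^-1] replaces the minimum of [b], which has no meaning for [n = 0]. *)
pose S := 1 + \sum_j (b j)^-1.
have sum0 : 0 <= \sum_j (b j)^-1 by rewrite sumr_ge0// => j _; rewrite invr_ge0 ltW.
exists S^-1; first by rewrite invr_gt0 /S; lra.
move=> j; rewrite -[leRHS]invrK lef_pV2 ?posrE ?invr_gt0//; last by rewrite /S; lra.
rewrite /S (bigD1 j)//= addrCA lerDl addr_ge0// sumr_ge0// => k _.
by rewrite invr_ge0 ltW.
Qed.
End RealAnalysis.

(** * A trace inequality of Klein type *)

Section Klein.
Variables (R : realType) (n : nat).
Implicit Types (M N P : 'M[R[i]]_n) (U W : 'M[R[i]]_n) (f g l b : 'I_n -> R).

(** A nonnegative kernel [\sum f(l_k) g(b_j)] stays nonnegative after summation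
    against the weights [|V k j|^2], [V = W U^*]. *)
Lemma retr_specmx_mul_ge0 W U (s : seq (('I_n -> R) * ('I_n -> R))) :
  (forall k j, 0 <= \sum_(p <- s) p.1 k * p.2 j) ->
  0 <= \sum_(p <- s) retr (specmx W p.1 *m specmx U p.2).
Proof.
move=> h; under eq_bigr do rewrite retr_specmx_mul.
rewrite exchange_big sumr_ge0// => k _; rewrite exchange_big sumr_ge0// => j _.
under eq_bigr do rewrite -mulrA; rewrite -mulr_sumr mulr_ge0//.
have : 0 <= `|(W *m U^t*) k j| ^+ 2 by rewrite exprn_ge0.
by rewrite lecE => /andP[].
Qed.

Lemma retr_sqr_expand (X B Y : 'M[R[i]]_n) (K : R) :
  retr (Y *m (X - B)) + K * retr ((X - B) *m (X - B)) =
  retr (X *m Y) - retr (Y *m B) + K * retr (X *m X)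
   - 2 * K * retr (X *m B) + K * retr (B *m B).
Proof.
rewrite !mulmxBr !mulmxBl !(retrD, retrN).
by rewrite (retr_mulC Y X) (retr_mulC B X); ring.
Qed.

(** Klein's inequality for a function that need not be convex or concave: a
    parabola bound between the two spectra becomes a bound between traces.  All
    terms of the bound are sums of products of a function of [l_k] and a
    function of [b_j], so [retr_specmx_mul_ge0] applies. *)
Lemma klein_upper W U l b (phi : R -> R) psi K :
  W \is unitarymx -> U \is unitarymx ->
  (forall k j, phi (l k) <=
     phi (b j) + psi j * (l k - b j) + K * (l k - b j) ^+ 2) ->
  \sum_k phi (l k) <=
    \sum_j phi (b j) + retr (specmx U psi *m (specmx W l - specmx U b))
    + K * retr ((specmx W l - specmx U b) *m (specmx W l - specmx U b)).
Proof.
move=> uW uU h; pose one := fun _ : 'I_n => 1 : R.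
(* Right-hand side minus left-hand side, split into terms [f (l_k) g (b_j)]. *)
pose s : seq (('I_n -> R) * ('I_n -> R)) :=
  [:: (one, fun j => phi (b j)); (l, psi); (fun=> -1, fun j => psi j * b j);
      (fun k => K * (l k * l k), one); (fun k => - (2 * K) * l k, b);
      (fun=> K, fun j => b j * b j); (fun k => -1 * phi (l k), one)].
have := @retr_specmx_mul_ge0 W U s; rewrite !big_cons !big_nil /=.
have cst (c : R) : specmx W (fun=> c) = c%:C%:M.
  rewrite -scalemx1 -(specmx1 uW) specmxZ; apply: eq_specmx => k.
  by rewrite mulr1.
rewrite !cst -!specmxZ -!(specmxM _ _ uU) -!(specmxM _ _ uW) !(specmx1 uU).
rewrite !mulmx1 !mul_scalar_mx -!scalemxAl !retrZ !retr_specmx// mul1r => pos.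
have {pos}/pos : forall k j, 0 <= \sum_(p <- s) p.1 k * p.2 j.
  move=> k j; have := h k j; rewrite !big_cons big_nil /= /one; lra.
rewrite -[_ + retr _ + _]addrA retr_sqr_expand.
move: (retr _) (retr _) (retr _) (retr _) (retr _) (\sum_j _) (\sum_j _).
move=> t1 t2 t3 t4 t5 t6 t7; lra.
Qed.

End Klein.

(** * First variation of the squared distance *)

Section Stretch.
Variables (C : numClosedFieldType) (n : nat).
Implicit Types (P A B : 'M[C]_n) (s t a : C).

(** For an orthogonal projection [P], this stretches the range of [P] by the
    factor [1 + s] and fixes its kernel. *)
Definition stretch s P : 'M[C]_n := 1%:M + s *: P.

Lemma stretch_adj s P : s \is Num.real -> P^t* = P -> (stretch s P)^t* = stretch s P.
Proof. by move=> sr hP; rewrite adjmxD adjmx1 adjmxZ hP conj_Creal. Qed.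

Lemma stretch_unit s P : P *m P = P -> 1 + s != 0 -> stretch s P \in unitmx.
Proof.
move=> PP s1.
suff h : stretch s P *m stretch (- (s / (1 + s))) P = 1%:M.
  by have [] := mulmx1_unit h.
rewrite /stretch mulmxDl !mulmxDr !mulmx1 mul1mx -scalemxAr -scalemxAl PP.
by apply/matrixP => i j; rewrite !mxE; field.
Qed.

Lemma stretch_sqr s P : P *m P = P ->
  stretch s P *m stretch s P = 1%:M + (2 * s + s ^+ 2) *: P.
Proof.
move=> PP; rewrite /stretch mulmxDl !mulmxDr !mulmx1 mul1mx -scalemxAr -scalemxAl PP.
by apply/matrixP => i j; rewrite !mxE; ring.
Qed.

Lemma stretch_conj s P B :
  stretch s P *m B *m stretch s P - B =
  s *: (P *m B + B *m P) + s ^+ 2 *: (P *m B *m P).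
Proof.
rewrite /stretch !mulmxDl !mulmxDr !mulmx1 !mul1mx -!scalemxAr -!scalemxAl.
by apply/matrixP => i j; rewrite !mxE; ring.
Qed.

(** The matrix identity behind [stretch_spectrum_lbound]: with [B >= a >= 0] and
    a real [s >= - 1/2], the left-hand side is a sum of positive semidefinite
    matrices. *)
Lemma stretch_shift s a P B : P *m P = P ->
  stretch s P *m (B - a *: 1%:M) *m stretch s P
    + a *: ((3 / 4) *: (1%:M - P) + ((1 + s) ^+ 2 - 1 / 4) *: P) =
  stretch s P *m B *m stretch s P - (a / 4) *: 1%:M.
Proof.
move=> PP; rewrite mulmxBr mulmxBl -scalemxAr mulmx1 -scalemxAl stretch_sqr//.
move: (_ *m _ *m _) => X.
by apply/matrixP => i j; rewrite !mxE; field.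
Qed.

Lemma sqr_comb2 s t A B :
  (s *: A + t *: B) *m (s *: A + t *: B) =
  (s * s) *: (A *m A) + (s * t) *: (A *m B + B *m A) + (t * t) *: (B *m B).
Proof.
rewrite mulmxDr !mulmxDl -!scalemxAr -!scalemxAl.
by apply/matrixP => i j; rewrite !mxE; ring.
Qed.
End Stretch.

Section FirstVariation.
Variables (R : realType) (n : nat).
Implicit Types (M N P : 'M[R[i]]_n) (U W : 'M[R[i]]_n) (f g l b : 'I_n -> R).

(** For [|s| <= 1/2] the matrix [1 + s P] multiplies the norm of a vector by at
    least [1/2], hence quadratic forms by at least [1/4].  This keeps the spectrum away
    from [0] uniformly in [s], as [ln_sqr_tangent] requires. *)
Lemma stretch_spectrum_lbound P U W b l (a s : R) :
  P^t* = P -> P *m P = P -> U \is unitarymx -> W \is unitarymx ->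
  0 <= a -> (forall j, a <= b j) -> `|s| <= 2^-1 ->
  stretch s%:C P *m specmx U b *m stretch s%:C P = specmx W l ->
  forall k, a / 4 <= l k.
Proof.
move=> hP PP uU uW a0 ab sh e k.
have sr : s%:C \is Num.real by apply/complex_realP; exists s.
rewrite -subr_ge0; apply: (specmx_psd_ge0 (g := fun k => l k - a / 4) uW).
rewrite specmxB_cst// -e.
have -> : (a / 4)%:C = a%:C / 4 by rewrite rmorphM fmorphV rmorph_nat.
rewrite -(stretch_shift s%:C a%:C _ PP) -specmxB_cst//.
have -> : 3 / 4 = (3 / 4)%:C :> R[i] by rewrite rmorphM fmorphV !rmorph_nat.
have -> : (1 + s%:C) ^+ 2 - 1 / 4 = ((1 + s) ^+ 2 - 1 / 4)%:C.
  by rewrite !(rmorphB, rmorphXn, rmorphD, rmorphM, fmorphV, rmorph1, rmorph_nat).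
rewrite -{1}(stretch_adj sr hP).
apply: psdmxD; first by apply/psdmx_congr/specmx_psd => j; rewrite subr_ge0.
apply: psdmxZ => //; apply: psdmxD; apply: psdmxZ.
- by lra.
- exact: proj_compl_psd.
- have : - s <= `|s| by rewrite -normrN ler_norm.
  by move=> ?; nra.
- exact: proj_psd.
Qed.

(** The first-order term: the derivative [2 ln x / x] of [ln^2], taken at the
    matrix [B], commutes with [B], and by cyclicity of the trace both halves of
    [P B + B P] contribute [2 tr (log B P)]. *)
Lemma retr_log_comm P U b : U \is unitarymx -> (forall j, 0 < b j) ->
  retr (specmx U (fun j => 2 * (ln (b j) / b j)) *m
        (P *m specmx U b + specmx U b *m P)) =
  4 * retr (specmx U (fun j => ln (b j)) *m P).
Proof.
move=> uU b0; rewrite mulmxDr retrD [in X in X + _]retr_mulC -[in X in X + _]mulmxA.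
rewrite [in X in X + _]retr_mulC mulmxA.
have E : specmx U b *m specmx U (fun j => 2 * (ln (b j) / b j)) =
         2%:C *: specmx U (fun j => ln (b j)).
  rewrite specmxM// specmxZ; apply: eq_specmx => j.
  by field; rewrite gt_eqF.
have E' : specmx U (fun j => 2 * (ln (b j) / b j)) *m specmx U b =
         2%:C *: specmx U (fun j => ln (b j)).
  rewrite specmxM// specmxZ; apply: eq_specmx => j.
  by field; rewrite gt_eqF.
by rewrite E E' -scalemxAl retrZ; ring.
Qed.

(** Only an upper bound with a quadratic error is needed, because it is used
    for both signs of [s] at a minimum.  The constant [K] does not depend on
    the spectral decomposition [W, l] of the perturbed matrix. *)
Lemma sum_ln_sqr_stretch P U b :
  P^t* = P -> P *m P = P -> U \is unitarymx -> (forall j, 0 < b j) ->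
  exists K : R, forall (s : R) W l, `|s| <= 2^-1 -> W \is unitarymx ->
    stretch s%:C P *m specmx U b *m stretch s%:C P = specmx W l ->
    \sum_k ln (l k) ^+ 2 <= \sum_j ln (b j) ^+ 2
      + 4 * retr (specmx U (fun j => ln (b j)) *m P) * s + K * s ^+ 2.
Proof.
move=> hP PP uU b0; have [a a0 ab] := posfun_lbound b0.
pose B := specmx U b; pose Psi := specmx U (fun j => 2 * (ln (b j) / b j)).
pose N0 := P *m B + B *m P; pose N1 := P *m B *m P.
pose S := \sum_j `|ln (b j)|.
(* [S] bounds every [|ln b_j|], so that one [K0] serves all indices. *)
pose K0 := (2 + 2 * S) / (a / 4) ^+ 2.
have S0 : 0 <= S by rewrite sumr_ge0.
have K00 : 0 <= K0 by rewrite divr_ge0 ?sqr_ge0//; lra.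
pose c0 := retr (N0 *m N0); pose c1 := retr (N0 *m N1) + retr (N1 *m N0).
pose c2 := retr (N1 *m N1).
exists (`|retr (Psi *m N1)| + K0 * (`|c0| + `|c1| + `|c2|)) => s W l sh uW e.
have la := stretch_spectrum_lbound hP PP uU uW (ltW a0) ab sh e.
have := @klein_upper R n W U l b (fun x => ln x ^+ 2)
  (fun j => 2 * (ln (b j) / b j)) K0 uW uU _.
move=> /(_ _)/le_trans; apply.
  move=> k j; apply: le_trans (ln_sqr_tangent (_ : 0 < a / 4) _ (la k)) _.
  - lra.
  - by apply: le_trans (ab j); lra.
  - rewrite lerD2l ler_wpM2r ?sqr_ge0// /K0 ler_wpM2r ?invr_ge0 ?sqr_ge0//.
    by rewrite lerD2l ler_wpM2l// /S (bigD1 j)//= lerDl sumr_ge0.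
rewrite -e stretch_conj -/B -/N0 -/N1 -/Psi.
have -> : retr (Psi *m (s%:C *: N0 + s%:C ^+ 2 *: N1)) =
   4 * retr (specmx U (fun j => ln (b j)) *m P) * s + retr (Psi *m N1) * s ^+ 2.
  rewrite mulmxDr -!scalemxAr retrD -rmorphXn/= !retrZ retr_log_comm//; ring.
have -> : retr ((s%:C *: N0 + s%:C ^+ 2 *: N1) *m (s%:C *: N0 + s%:C ^+ 2 *: N1)) =
   s ^+ 2 * (c0 + c1 * s + c2 * s ^+ 2).
  rewrite sqr_comb2 -rmorphXn -!rmorphM !(retrD, retrZ).
  by rewrite /c0 /c1 /c2; ring.
have s2 : s ^+ 2 <= 1.
  by rewrite -real_normK ?num_real// expr_le1//; lra.
have c1s : c1 * s <= `|c1|.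
  by apply: le_trans (ler_norm _) _; rewrite normrM ler_piMr//; lra.
have c2s : c2 * s ^+ 2 <= `|c2|.
  apply: le_trans (ler_norm _) _; rewrite normrM ler_piMr// ger0_norm ?sqr_ge0//.
have c0s := ler_norm c0; have n1s := ler_norm (retr (Psi *m N1)).
have h1 : retr (Psi *m N1) * s ^+ 2 <= `|retr (Psi *m N1)| * s ^+ 2.
  by rewrite ler_wpM2r ?sqr_ge0.
have h2 : K0 * (s ^+ 2 * (c0 + c1 * s + c2 * s ^+ 2)) <=
    K0 * (s ^+ 2 * (`|c0| + `|c1| + `|c2|)).
  by rewrite !ler_wpM2l ?sqr_ge0//; lra.
by lra.
Qed.

(** When [X^-1 = Z Z^*], the matrix [X^-1 A = Z (Z^* A Z) Z^-1] is similar to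
    the Hermitian matrix [Z^* A Z]. *)
Lemma trace_dist_sqr (X A Z W : 'M[R[i]]_n) l :
  Z \in unitmx -> invmx X = Z *m Z^t* -> W \is unitarymx ->
  Z^t* *m A *m Z = specmx W l ->
  trace_dist X A ^+ 2 = \sum_k ln (l k) ^+ 2.
Proof.
move=> uZ eX uW e; rewrite /trace_dist sqr_sqrtr ?sumr_ge0//; last first.
  by move=> z _; rewrite sqr_ge0.
have pe : perm_eq (eigenvalues (invmx X *m A)) [seq (l k)%:C | k <- index_enum 'I_n].
  apply: prod_XsubC_eq; rewrite -char_poly_eigenvalues big_map.
  rewrite -(char_poly_conj (invmx X *m A) uZ) eX !mulmxA mulVmx// mul1mx e.
  rewrite specmx.unlock udiag_char_poly//.
  by apply: eq_bigr => j _; rewrite mxE.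
by rewrite (perm_big _ pe) big_map.
Qed.

End FirstVariation.

(** * The Karcher equation and the bounds on the mean *)

Section LeastSquares.
Variables (R : realType) (m n : nat).
Variables (A : 'I_n -> 'M[R[i]]_m) (w : 'I_n -> R) (G T : 'M[R[i]]_m).
Variables (U : 'I_n -> 'M[R[i]]_m) (b : 'I_n -> 'I_m -> R).
Hypotheses (hA : forall i, pdmx (A i)) (hw : is_weight w)
  (hG : is_least_squares_mean w A G).
Hypotheses (uT : T \in unitmx) (TGT : T^t* *m G *m T = 1%:M).
Hypotheses (uU : forall i, U i \is unitarymx) (b0 : forall i j, 0 < b i j)
  (TAT : forall i, T^t* *m A i *m T = specmx (U i) (b i)).

(** The weighted sum of the logarithms of the whitened matrices vanishes,
    in the weak form of its traces against projections: [G] is compared with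
    the positive definite [X] such that [X^-1 = T (1 + s P)^2 T^*]. *)
Lemma karcher_equation (P : 'M[R[i]]_m) : P^t* = P -> P *m P = P ->
  \sum_i w i * retr (specmx (U i) (fun j => ln (b i j)) *m P) = 0.
Proof.
move=> hP PP.
have [K hK] := choice (fun i => sum_ln_sqr_stretch hP PP (uU i) (b0 i)).
set L := \sum_i _.
suff : 4 * L = 0 by move/eqP; rewrite mulf_eq0 pnatr_eq0 => /eqP.
apply: (@first_order_zero _ _ (\sum_i w i * K i)) => s sh.
have sr : s%:C \is Num.real by apply/complex_realP; exists s.
have s1 : 1 + s%:C != 0.
  have : - s <= `|s| by rewrite -normrN ler_norm.
  move=> ?; rewrite -(rmorph1 (real_complex R)) -rmorphD fmorph_eq0.
  by rewrite gt_eqF//; lra.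
have uY := stretch_unit PP s1.
pose Z := T *m stretch s%:C P.
have uZ : Z \in unitmx by rewrite unitmx_mul uT.
have := hG.2 _ (gram_pdmx uZ).
have distG i : trace_dist G (A i) ^+ 2 = \sum_j ln (b i j) ^+ 2.
  exact: trace_dist_sqr uT (invmx_congr_eq1 uT TGT) (uU i) (TAT i).
have distX i : trace_dist (invmx (Z *m Z^t*)) (A i) ^+ 2 <= \sum_j ln (b i j) ^+ 2
      + 4 * retr (specmx (U i) (fun j => ln (b i j)) *m P) * s + K i * s ^+ 2.
  have /pdmx_specmx[W [l [uW _ e]]] := pdmx_congr uZ (hA i).
  rewrite (trace_dist_sqr uZ (invmxK _) uW e); apply: hK sh uW _.
  by rewrite -e /Z adjmxM (stretch_adj sr hP) -TAT !mulmxA.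
move=> /le_trans /(_ (ler_sum _ (fun i _ => ler_wpM2l (ltW (hw.1 i)) (distX i)))).
rewrite -subr_ge0 -sumrB.
suff -> : \sum_i (w i * (\sum_j ln (b i j) ^+ 2
      + 4 * retr (specmx (U i) (fun j => ln (b i j)) *m P) * s + K i * s ^+ 2)
      - w i * trace_dist G (A i) ^+ 2) =
      4 * L * s + (\sum_i w i * K i) * s ^+ 2 by [].
rewrite /L mulr_sumr !mulr_suml -big_split/=; apply: eq_bigr => i _.
by rewrite distG; ring.
Qed.

(** By the Karcher equation, multiples of the logarithms can be added for free
    in the weighted sum.  The case [eps = 1], [f = b] gives the upper bound on
    the mean, and [eps = -1], [f = b^-1] the lower bound. *)
Lemma weighted_spectral_ge1 (eps : R) (f : 'I_n -> 'I_m -> R) :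
  (forall i j, 1 + eps * ln (b i j) <= f i j) ->
  psdmx (\sum_i (w i)%:C *: specmx (U i) (f i) - 1%:M).
Proof.
move=> hf; apply: psdmx_proj => [|P hP PP].
  rewrite adjmxB adjmx1; congr (_ - _); rewrite adjmx_sum; apply: eq_bigr => i _.
  by rewrite adjmxZ specmx_adj conj_realC.
have e : \sum_i (w i)%:C *: specmx (U i) (f i) - 1%:M =
    \sum_i (w i)%:C *: specmx (U i) (fun j => f i j - 1).
  have {1}-> : 1%:M = \sum_i (w i)%:C *: (1%:M : 'M[R[i]]_m).
    by rewrite -scaler_suml -rmorph_sum hw.2 scale1r.
  rewrite -sumrB; apply: eq_bigr => i _.
  by rewrite specmxB_cst// scale1r scalerBr.
have := congr1 ( *%R eps) (karcher_equation hP PP); rewrite mulr0 => <-.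
rewrite e mulmx_suml retr_sum mulr_sumr.
apply: ler_sum => i _; rewrite -scalemxAl retrZ mulrCA ler_wpM2l ?(ltW (hw.1 i))//.
rewrite -retrZ scalemxAl specmxZ -subr_ge0 -retrN -retrD -mulNmx -mulmxDl specmxB.
apply: retr_mul_proj_ge0 => //; apply: specmx_psd => j.
by have := hf i j; lra.
Qed.

End LeastSquares.

Theorem proposition7p1 (R : realType) (m n : nat)
    (A : 'I_n -> 'M[R[i]]_m) (w : 'I_n -> R) (G : 'M[R[i]]_m)
    (hA : forall i, pdmx (A i)) (hw : is_weight w)
    (hG : is_least_squares_mean w A G) :
  loewner_le (invmx (\sum_(i < n) (w i)%:C *: invmx (A i))) G /\
  loewner_le G (\sum_(i < n) (w i)%:C *: A i).
Proof.
have [pG _] := hG; have [T uT TGT] := whitening pG.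
have spec i : exists Ub : 'M[R[i]]_m * ('I_m -> R),
    [/\ Ub.1 \is unitarymx, forall j, 0 < Ub.2 j & T^t* *m A i *m T = specmx Ub.1 Ub.2].
  by have /pdmx_specmx[U [b H]] := pdmx_congr uT (hA i); exists (U, b).
have [Ub hUb] := choice spec.
have uU i : (Ub i).1 \is unitarymx by case: (hUb i).
have b0 i : forall j, 0 < (Ub i).2 j by case: (hUb i).
have TAT i : T^t* *m A i *m T = specmx (Ub i).1 (Ub i).2 by case: (hUb i).
have key := weighted_spectral_ge1 hA hw hG uT TGT uU b0 TAT.
split.
  have iG := invmx_congr_eq1 uT TGT; have piG := pdmx_inv pG.
  have le : loewner_le (invmx G) (\sum_i (w i)%:C *: invmx (A i)).
    have uZ : (invmx T)^t* \in unitmx by rewrite adjmx_unit ?unitmx_inv.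
    apply: (psdmx_congr_unit uZ).
    have := key (-1) (fun i j => ((Ub i).2 j)^-1).
    have -> : \sum_i (w i)%:C *: specmx (Ub i).1 (fun j => ((Ub i).2 j)^-1) - 1%:M =
       ((invmx T)^t*)^t* *m (\sum_i (w i)%:C *: invmx (A i) - invmx G) *m (invmx T)^t*.
      rewrite trmxCK mulmxBr mulmxBl iG mulmx_sumr mulmx_suml adjmx_inv.
      rewrite mulKmx// mulmxV ?adjmx_unit//; congr (_ - _).
      apply: eq_bigr => i _; rewrite -scalemxAr -scalemxAl -adjmx_inv.
      by rewrite -(invmx_congr uT (pdmx_unit (hA i))) TAT invmx_specmx.
    apply => i j; have := ln_ge_1subV (b0 i j); lra.
  have pH : pdmx (\sum_i (w i)%:C *: invmx (A i)).
    by have := psdmx_pdmxD le piG; rewrite subrK.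
  by have := loewner_le_inv pH piG le; rewrite invmxK.
apply: (psdmx_congr_unit uT).
have := key 1 (fun i => (Ub i).2).
have -> : \sum_i (w i)%:C *: specmx (Ub i).1 (Ub i).2 - 1%:M =
    T^t* *m (\sum_i (w i)%:C *: A i - G) *m T.
  rewrite mulmxBr mulmxBl TGT mulmx_sumr mulmx_suml; congr (_ - _).
  by apply: eq_bigr => i _; rewrite -TAT -scalemxAr -scalemxAl.
apply => i j; have := ln_le_subr1 (b0 i j); lra.
Qed.
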